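(* For $k>0$ and $\alpha\in(0,\pi]$ let $\Gamma=\{(\cos\theta,\sin\theta):\theta\in(-\alpha,\alpha)\}$ and, for $y,z\in\mathbb{R}^2$, let $$K_\Gamma(z,y)=\int_{\Gamma}G^\infty(z,\hat x)\,\overline{G^\infty(y,\hat x)}\,d\hat x,\qquad R=|y-z|.$$ (1) There is a constant $C>0$, independent of $\alpha$ and of $kR$, such that whenever $R>0$, $$|K_\Gamma(z,y)|\le C\,k^{-3/2}R^{-1/2}.$$ (2) For fixed $\alpha$, $$\lim_{kR\to0}|K_\Gamma(z,y)|=\frac{\alpha}{4k\pi},$$ in the sense that $k\,|K_\Gamma(z,y)|\to\frac{\alpha}{4\pi}$ as $kR\to0$; moreover $\frac{\alpha}{4k\pi}$ is the maximum value of $|K_\Gamma(z,y)|$, that is, $|K_\Gamma(z,y)|\le\frac{\alpha}{4k\pi}$ for all $y,z$, with equality when $y=z$. (3) For fixed $k$, $y$, $z$ (hence fixed $kR$), $$|K_\Gamma(z,y)|=\frac{\alpha}{4k\pi}+o(\alpha)\qquad\text{as }\alpha\to0^+.$$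
   Context: $k>0$ is the wavenumber, $\mathbb{S}^1$ is the unit circle in $\mathbb{R}^2$ and $d\hat x$ is arc-length measure. The far-field pattern of the two-dimensional free-space Green's function is $$G^\infty(z,\hat x)=\frac{e^{\mathrm{i}\pi/4}}{\sqrt{8k\pi}}\,e^{-\mathrm{i}k\hat x\cdot z},\qquad z\in\mathbb{R}^2,\ \hat x\in\mathbb{S}^1.$$ *)

(* Defs.v *)
From Stdlib Require Import Reals.
From Coquelicot Require Import Coquelicot.

Open Scope R_scope.

Definition point : Type := (R * R)%type.

Definition dot (x z : point) : R := fst x * fst z + snd x * snd z.

(* Coquelicot's norm on a product of normed modules is the Euclidean one,
   sqrt (|a| ^ 2 + |b| ^ 2), not the sup norm. *)
Definition enorm (x : point) : R :=
  @norm R_AbsRing (prod_NormedModule R_AbsRing R_NormedModule R_NormedModule) x.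

Definition edist (y z : point) : R := enorm (fst y - fst z, snd y - snd z).

Definition Cexp (w : C) : C := (exp (fst w) * (cos (snd w), sin (snd w)))%C.

(* Integral of f with respect to arc length along the curve c restricted to
   (a, b), for c continuously differentiable and injective on (a, b). *)
Definition arc_length_integral (c : R -> point) (a b : R) (f : point -> C) : C :=
  @RInt C_R_CompleteNormedModule
    (fun t => (RtoC (enorm (Derive (fun s => fst (c s)) t,
                            Derive (fun s => snd (c s)) t)) * f (c t))%C)
    a b.

Definition circle (theta : R) : point := (cos theta, sin theta).

Definition Ginf (k : R) (z x : point) : C :=
  (Cexp (Ci * RtoC (PI / 4)) / RtoC (sqrt (8 * k * PI))
   * Cexp (- (Ci * RtoC (k * dot x z))))%C.

(* The arc Gamma is the injective image of (-alpha, alpha) under [circle];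
   injectivity uses alpha <= PI. *)
Definition KGamma (k alpha : R) (z y : point) : C :=
  arc_length_integral circle (- alpha) alpha
    (fun x => (Ginf k z x * Cconj (Ginf k y x))%C).

(* Main.v *)
Require Import Defs.
From Stdlib Require Import Reals Lra.
From Coquelicot Require Import Coquelicot.

Open Scope R_scope.

(** With z - y = R (cos phi, sin phi), the kernel is (8 k pi)^-1 times the
    integral I of exp(- i k R cos(t - phi)) over (- alpha, alpha).  Parts (2)
    and (3) hold because |I| <= 2 alpha, with a defect controlled by the
    oscillation of the phase.

    For (1), put q = sqrt (k R) and D = cos^2 + q^2 sin^2.  Adding to
    cos(q^2 cos t + c) the derivative of (sin / D) sin(q^2 cos t + c) cancels
    the oscillating part away from the stationary points and leaves a function
    bounded by 2 / D.  Since q / D is the derivative of the globally smooth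
    function t + atan ((q - 1) sin t cos t / (cos^2 t + q sin^2 t)), its
    integral over an interval of length at most 2 pi is at most 3 pi, and I is
    O(1 / q). *)

(** * Elementary inequalities for cosine, sine and plane vectors *)

Lemma cos_lipschitz (x y : R) : Rabs (cos x - cos y) <= Rabs (x - y).
Proof.
destruct (MVT_gen cos y x (fun t => - sin t)) as [t [_ ->]].
- intros t _; auto_derive; [trivial | ring].
- intros t _; apply continuity_pt_filterlim, continuous_cos.
- rewrite Rabs_mult.
  assert (Rabs (- sin t) <= 1)
    by (apply Rabs_le; pose proof (SIN_bound t); lra).
  pose proof (Rabs_pos (x - y)); nra.
Qed.

(** Lagrange's identity: the squares of the two sides differ by [(a * v - b * u) ^ 2]. *)
Lemma cauchy_schwarz_2 (a b u v : R) :
  a * u + b * v <= sqrt (a ^ 2 + b ^ 2) * sqrt (u ^ 2 + v ^ 2).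
Proof.
rewrite <- sqrt_mult by nra.
apply Rle_trans with (1 := Rle_abs _).
rewrite <- sqrt_Rsqr_abs; apply sqrt_le_1_alt; unfold Rsqr.
pose proof (pow2_ge_0 (a * v - b * u)); nra.
Qed.

Lemma cos_sin_pow2 (t : R) : cos t ^ 2 + sin t ^ 2 = 1.
Proof. pose proof (sin2_cos2 t); unfold Rsqr in *; lra. Qed.

Lemma is_RInt_cos_sin (psi : R -> R) (a b p r : R) :
  (forall t, continuous psi t) ->
  is_RInt (fun t => p * cos (psi t) + r * sin (psi t)) a b
    (p * RInt (fun t => cos (psi t)) a b + r * RInt (fun t => sin (psi t)) a b).
Proof.
intros Hpsi.
apply (@is_RInt_plus R_NormedModule); apply (@is_RInt_scal R_NormedModule);
  apply (@RInt_correct R_CompleteNormedModule);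
  apply (@ex_RInt_continuous R_CompleteNormedModule); intros t _.
- apply (continuous_comp psi cos); [apply Hpsi | apply continuous_cos].
- apply (continuous_comp psi sin); [apply Hpsi | apply continuous_sin].
Qed.

(** * Modulus of the integral of exp(i psi): bounds by length and by phase oscillation *)

(** Project the integrand on the integral [(A, B)] itself: the projection integrates to [N ^ 2] and
    is pointwise at most [N], so [N ^ 2 <= 2 * alpha * N]. *)
Lemma oscillatory_integral_le (psi : R -> R) (alpha : R) :
  (forall t, continuous psi t) -> 0 < alpha ->
  sqrt (RInt (fun t => cos (psi t)) (- alpha) alpha ^ 2
        + RInt (fun t => sin (psi t)) (- alpha) alpha ^ 2) <= 2 * alpha.
Proof.
intros Hpsi Halpha.
set (A := RInt _ _ _); set (B := RInt _ _ _).
set (N := sqrt (A ^ 2 + B ^ 2)).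
assert (HN : N * N = A * A + B * B).
{ unfold N; rewrite sqrt_sqrt by nra; ring. }
assert (HN0 : 0 <= N) by apply sqrt_pos.
assert (HNN : A * A + B * B <= (alpha - - alpha) * N).
{ apply (is_RInt_le (fun t => A * cos (psi t) + B * sin (psi t))
                    (fun _ => N) (- alpha) alpha).
  - lra.
  - exact (is_RInt_cos_sin psi (- alpha) alpha A B Hpsi).
  - apply (@is_RInt_const R_NormedModule).
  - intros t _; pose proof (cauchy_schwarz_2 A B (cos (psi t)) (sin (psi t))) as H.
    rewrite cos_sin_pow2, sqrt_1 in H; fold N in H; lra. }
nra.
Qed.

(** Project on the fixed direction [(cos c, sin c)] instead: the integrand becomes cos(psi - c),
    which is at least 1 - |psi - c| because cosine is 1-Lipschitz. *)
Lemma oscillatory_integral_ge (psi : R -> R) (alpha c M : R) :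
  (forall t, continuous psi t) -> 0 < alpha ->
  (forall t, Rabs t <= alpha -> Rabs (psi t - c) <= M) ->
  2 * alpha * (1 - M) <=
  sqrt (RInt (fun t => cos (psi t)) (- alpha) alpha ^ 2
        + RInt (fun t => sin (psi t)) (- alpha) alpha ^ 2).
Proof.
intros Hpsi Halpha HM.
set (A := RInt _ _ _); set (B := RInt _ _ _).
pose proof (cauchy_schwarz_2 A B (cos c) (sin c)) as H.
rewrite cos_sin_pow2, sqrt_1, Rmult_1_r in H.
apply Rle_trans with (2 := H).
assert (HI : (alpha - - alpha) * (1 - M) <= cos c * A + sin c * B).
{ apply (is_RInt_le (fun _ => 1 - M)
           (fun t => cos c * cos (psi t) + sin c * sin (psi t)) (- alpha) alpha).
  - lra.
  - apply (@is_RInt_const R_NormedModule).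
  - exact (is_RInt_cos_sin psi (- alpha) alpha (cos c) (sin c) Hpsi).
  - intros t Ht.
    assert (Hc : Rabs (psi t - c) <= M) by (apply HM, Rabs_le; lra).
    pose proof (cos_lipschitz (psi t - c) 0) as Hl.
    rewrite cos_0, Rminus_0_r in Hl.
    rewrite cos_minus in Hl.
    apply Rabs_le_between in Hl; lra. }
lra.
Qed.

(** * Decay of oscillatory integrals by a corrector and an integrable majorant *)

(** This is integration by parts in disguise: [P] supplies the boundary terms and [W] dominates the
    remainder. Primitives are compared by the mean value theorem, so [dP] and [dW] are never
    integrated. *)
Lemma RInt_le_corrector (f P dP W dW : R -> R) (a b : R) :
  (forall t, continuous f t) ->
  (forall t, is_derive P t (dP t)) ->
  (forall t, is_derive W t (dW t)) ->
  (forall t, Rabs (f t + dP t) <= dW t) ->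
  a <= b ->
  Rabs (RInt f a b) <= Rabs (P b - P a) + (W b - W a).
Proof.
intros Hf HP HW Hle Hab.
set (F := fun t => RInt f a t).
assert (HF : forall t, is_derive F t (f t)).
{ intros t; apply (is_derive_RInt f F a t); [|apply Hf].
  apply filter_forall; intros s; unfold F.
  apply (@RInt_correct R_CompleteNormedModule),
    (@ex_RInt_continuous R_CompleteNormedModule); intros; apply Hf. }
assert (HFa : F a = 0) by apply (@RInt_point R_CompleteNormedModule).
change (RInt f a b) with (F b).
(* For either sign [s], the function [s * (F + P) - W] has nonpositive derivative. *)
assert (H1 : forall s, s = 1 \/ s = -1 -> s * (F b + P b - P a) <= W b - W a).
{ intros s Hs.
  destruct (MVT_gen (fun t => s * (F t + P t) - W t) a b
              (fun t => s * (f t + dP t) - dW t)) as [t [_ Ht]].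
  - intros t _.
    apply (@is_derive_minus R_AbsRing R_NormedModule); [|apply HW].
    apply is_derive_scal.
    apply (@is_derive_plus R_AbsRing R_NormedModule); [apply HF | apply HP].
  - intros t _; apply continuity_pt_minus.
    + apply continuity_pt_scal with (f := fun t => F t + P t).
      apply continuity_pt_plus; apply continuity_pt_filterlim;
        apply (@ex_derive_continuous R_AbsRing R_NormedModule); eexists;
        [apply HF | apply HP].
    + apply continuity_pt_filterlim,
        (@ex_derive_continuous R_AbsRing R_NormedModule); eexists; apply HW.
  - pose proof (Hle t) as Hl; apply Rabs_le_between in Hl.
    assert (s * (f t + dP t) - dW t <= 0) by (destruct Hs; subst s; lra).
    rewrite HFa in Ht; nra. }
pose proof (H1 1 (or_introl eq_refl)); pose proof (H1 (-1) (or_intror eq_refl)).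
pose proof (Rle_abs (P b - P a)); pose proof (Rle_abs (- (P b - P a))) as H3.
rewrite Rabs_Ropp in H3.
apply Rabs_le; lra.
Qed.

Section VanDerCorput.

Variables (q c : R).
Hypothesis Hq : 1 <= q.

Let D (t : R) := cos t ^ 2 + q ^ 2 * sin t ^ 2.
Let E (t : R) := cos t ^ 2 + q * sin t ^ 2.
(** Plain integration by parts would use 1 / (q^2 sin t), the inverse of the phase derivative up to
    sign. The factor [sin t / D t] regularises it at the stationary points, where sin t = 0. *)
Let P (t : R) := sin t / D t * sin (q ^ 2 * cos t + c).
(** Up to the factor 2 / q this is atan(q tan t), continued across the poles of tan: the subtraction
    formula for atan splits off [t] and leaves a quotient with denominator [E t >= 1]. *)
Let W (t : R) := 2 / q * (t + atan ((q - 1) * sin t * cos t / E t)).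

Lemma weight_ge_1 (t : R) : 1 <= D t.
Proof.
unfold D; pose proof (cos_sin_pow2 t); pose proof (pow2_ge_0 (sin t)).
assert (1 <= q ^ 2) by nra; nra.
Qed.

Lemma weight1_ge_1 (t : R) : 1 <= E t.
Proof.
unfold E; pose proof (cos_sin_pow2 t); pose proof (pow2_ge_0 (sin t)); nra.
Qed.

Lemma is_derive_weight_primitive (t : R) : is_derive W t (2 / D t).
Proof.
pose proof (weight_ge_1 t); pose proof (weight1_ge_1 t) as HE.
unfold W, E; unfold D, E in *; auto_derive.
- lra.
- pose proof (cos_sin_pow2 t) as Hcs.
  set (s := sin t) in *; set (x := cos t) in *.
  (* Up to the common factor [E ^ 2], this is the denominator 1 + u^2 in the derivative of atan u;
     it collapses to [D]. *)
  assert (Hfac : (x ^ 2 + q * s ^ 2) ^ 2 + ((q - 1) * s * x) ^ 2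
                 = x ^ 2 + q ^ 2 * s ^ 2).
  { transitivity ((x ^ 2 + s ^ 2) * (x ^ 2 + q ^ 2 * s ^ 2)); [ring|].
    rewrite Hcs; ring. }
  assert (Hnum : (q - 1) * (x ^ 2 - s ^ 2) * (x ^ 2 + q * s ^ 2)
                 - (q - 1) * s * x * (2 * (q - 1) * s * x)
                 = (q - 1) * (x ^ 2 - q * s ^ 2)).
  { transitivity ((q - 1) * (x ^ 2 + s ^ 2) * (x ^ 2 - q * s ^ 2)); [ring|].
    rewrite Hcs; ring. }
  apply Rminus_diag_uniq.
  match goal with |- ?l - _ = 0 => replace l with
    (2 / q * (1 + ((q - 1) * (x ^ 2 - s ^ 2) * (x ^ 2 + q * s ^ 2)
                 - (q - 1) * s * x * (2 * (q - 1) * s * x))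
              / ((x ^ 2 + q * s ^ 2) ^ 2 + ((q - 1) * s * x) ^ 2))) end.
  + rewrite Hnum, Hfac.
    replace (x ^ 2) with (1 - s ^ 2) in * by lra.
    field; lra.
  + field; repeat split; try lra; try (rewrite Hfac; lra); nra.
Qed.

(** The linear term grows by at most 2 pi and the arctangent varies by less than pi, giving 3 pi
    times the factor 2 / q. *)
Lemma weight_primitive_increment (a b : R) :
  b - a <= 2 * PI -> W b - W a <= 6 * PI / q.
Proof.
intros Hab; unfold W.
pose proof (atan_bound ((q - 1) * sin b * cos b / E b)).
pose proof (atan_bound ((q - 1) * sin a * cos a / E a)).
rewrite <- Rmult_minus_distr_l.
replace (6 * PI / q) with (2 / q * (3 * PI)) by (field; lra).
apply Rmult_le_compat_l; [|lra].
apply Rlt_le, Rdiv_lt_0_compat; lra.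
Qed.

(** [D t] dominates both 1 and (q sin t)^2, hence also q |sin t|, whichever side of 1 the latter
    lies on. *)
Lemma corrector_le (t : R) : Rabs (P t) <= 1 / q.
Proof.
unfold P; rewrite Rabs_mult.
set (u := Rabs (sin (q ^ 2 * cos t + c))).
assert (Hu : 0 <= u <= 1).
{ unfold u; split; [apply Rabs_pos|].
  apply Rabs_le; pose proof (SIN_bound (q ^ 2 * cos t + c)); lra. }
assert (HD := weight_ge_1 t).
unfold Rdiv; rewrite Rabs_mult, Rabs_inv, (Rabs_right (D t)) by lra.
assert (Hs : Rabs (sin t) * / D t <= 1 * / q).
{ apply (Rmult_le_reg_r (D t * q)); [nra|].
  replace (Rabs (sin t) * / D t * (D t * q)) with (q * Rabs (sin t)) by (field; lra).
  replace (1 * / q * (D t * q)) with (D t) by (field; lra).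
  assert (HD2 : q ^ 2 * Rabs (sin t) ^ 2 <= D t).
  { rewrite pow2_abs; unfold D; pose proof (pow2_ge_0 (cos t)); lra. }
  destruct (Rle_dec (q * Rabs (sin t)) 1); nra. }
assert (0 <= Rabs (sin t) * / D t).
{ apply Rmult_le_pos; [apply Rabs_pos | apply Rlt_le, Rinv_0_lt_compat; lra]. }
nra.
Qed.

(** The two boundary values of [P] contribute 1 / q each, and the increment of [W] contributes 6 pi
    / q. *)
Lemma cos_phase_integral_le (a b : R) :
  a <= b <= a + 2 * PI ->
  Rabs (RInt (fun t => cos (q ^ 2 * cos t + c)) a b) <= (2 + 6 * PI) / q.
Proof.
intros Hab.
set (ph := fun t => q ^ 2 * cos t + c).
(* [dh] is the derivative of sin / D. *)
set (dh := fun t => cos t * (cos t ^ 2 - q ^ 2 * sin t ^ 2 + 2 * sin t ^ 2)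
                    / D t ^ 2).
set (dP := fun t => dh t * sin (ph t)
                    - sin t / D t * (q ^ 2 * sin t) * cos (ph t)).
assert (HP : forall t, is_derive P t (dP t)).
{ intros t; pose proof (weight_ge_1 t) as HD.
  unfold P, dP, dh, ph, D in *; auto_derive; [lra|].
  change (q * (q * 1)) with (q ^ 2).
  field; lra. }
assert (Hbound : forall t, Rabs (cos (ph t) + dP t) <= 2 / D t).
{ intros t; pose proof (weight_ge_1 t) as HD; pose proof (cos_sin_pow2 t) as Hcs.
  assert (Hi : 0 < / D t) by (apply Rinv_0_lt_compat; lra).
  (* The cosine terms combine through 1 - q^2 sin^2 / D = cos^2 / D, so the coefficient of cos(ph)
     is now of order 1 / D. *)
  replace (cos (ph t) + dP t)
    with ((cos t ^ 2 * cos (ph t) + dh t * D t * sin (ph t)) * / D t)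
    by (unfold dP, D in *; field; lra).
  rewrite Rabs_mult, (Rabs_right (/ D t)) by lra.
  apply Rmult_le_compat_r; [lra|].
  assert (Hdh : Rabs (dh t * D t) <= 1).
  { replace (dh t * D t)
      with (cos t * (cos t ^ 2 - q ^ 2 * sin t ^ 2 + 2 * sin t ^ 2) * / D t)
      by (unfold dh; field; lra).
    rewrite !Rabs_mult, (Rabs_right (/ D t)) by lra.
    apply (Rmult_le_reg_r (D t)); [lra|].
    rewrite Rmult_assoc, Rinv_l, Rmult_1_r, Rmult_1_l by lra.
    assert (Rabs (cos t) <= 1)
      by (apply Rabs_le; pose proof (COS_bound t); lra).
    assert (Rabs (cos t ^ 2 - q ^ 2 * sin t ^ 2 + 2 * sin t ^ 2) <= D t).
    { pose proof (pow2_ge_0 (sin t)); pose proof (pow2_ge_0 (cos t)).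
      assert (1 <= q ^ 2) by nra.
      apply Rabs_le; unfold D; nra. }
    pose proof (Rabs_pos (cos t)).
    pose proof (Rabs_pos (cos t ^ 2 - q ^ 2 * sin t ^ 2 + 2 * sin t ^ 2)); nra. }
  apply Rle_trans with (1 := Rabs_triang _ _).
  rewrite (Rabs_mult (cos t ^ 2)), (Rabs_mult (dh t * D t)).
  assert (Rabs (cos (ph t)) <= 1)
    by (apply Rabs_le; pose proof (COS_bound (ph t)); lra).
  assert (Rabs (sin (ph t)) <= 1)
    by (apply Rabs_le; pose proof (SIN_bound (ph t)); lra).
  assert (Rabs (cos t ^ 2) <= 1).
  { apply Rabs_le; pose proof (pow2_ge_0 (sin t));
      pose proof (pow2_ge_0 (cos t)); lra. }
  pose proof (Rabs_pos (cos (ph t))); pose proof (Rabs_pos (sin (ph t)));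
    pose proof (Rabs_pos (cos t ^ 2)); pose proof (Rabs_pos (dh t * D t)); nra. }
assert (Hf : forall t, continuous (fun t => cos (ph t)) t).
{ intros t; apply (@ex_derive_continuous R_AbsRing R_NormedModule).
  unfold ph; auto_derive; trivial. }
pose proof (RInt_le_corrector (fun t => cos (ph t)) P dP W (fun t => 2 / D t) a b
              Hf HP is_derive_weight_primitive Hbound (proj1 Hab)) as H.
pose proof (weight_primitive_increment a b ltac:(lra)).
pose proof (Rabs_triang (P b) (- P a)) as Ht; rewrite Rabs_Ropp in Ht.
pose proof (corrector_le a); pose proof (corrector_le b).
replace ((2 + 6 * PI) / q) with (1 / q + 1 / q + 6 * PI / q) by (field; lra).
unfold ph in H; unfold Rminus in *; lra.
Qed.

End VanDerCorput.

(** * Decay in lambda, uniformly in the interval and the shift *)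

(** Translation by [phi] reduces to the previous bound with [q = sqrt lambda]. The constant [c] is
    kept so that a quarter-turn shift also covers the sine integral. *)
Lemma cos_shifted_phase_integral_le (lambda phi c alpha : R) :
  1 <= lambda -> 0 < alpha <= PI ->
  Rabs (RInt (fun t => cos (lambda * cos (t - phi) + c)) (- alpha) alpha)
    <= (2 + 6 * PI) / sqrt lambda.
Proof.
intros Hl Ha.
assert (Hq : 1 <= sqrt lambda) by (rewrite <- sqrt_1; apply sqrt_le_1_alt, Hl).
pose proof (cos_phase_integral_le (sqrt lambda) c Hq
              (- alpha - phi) (alpha - phi) ltac:(lra)) as H.
rewrite pow2_sqrt in H by lra.
replace (RInt (fun t => cos (lambda * cos (t - phi) + c)) (- alpha) alpha)
  with (RInt (fun t => cos (lambda * cos t + c)) (- alpha - phi) (alpha - phi));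
  [exact H|].
replace (- alpha - phi) with (1 * - alpha + - phi) by ring.
replace (alpha - phi) with (1 * alpha + - phi) by ring.
rewrite <- (@RInt_comp_lin R_CompleteNormedModule).
- apply (@RInt_ext R_CompleteNormedModule); intros t _.
  change (1 * cos (lambda * cos (1 * t + - phi) + c)
          = cos (lambda * cos (t - phi) + c)).
  rewrite !Rmult_1_l; reflexivity.
- apply (@ex_RInt_continuous R_CompleteNormedModule); intros t _.
  apply (@ex_derive_continuous R_AbsRing R_NormedModule); auto_derive; trivial.
Qed.

(** For [lambda >= 1] the modulus is at most |A| + |B|, each bounded above. For [lambda < 1] the
    trivial bound 2 alpha <= 2 pi suffices, since [sqrt lambda <= 1]. *)
Lemma oscillatory_integral_decay (lambda phi alpha : R) :
  0 < lambda -> 0 < alpha <= PI ->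
  sqrt (RInt (fun t => cos (lambda * cos (t - phi))) (- alpha) alpha ^ 2
        + RInt (fun t => sin (lambda * cos (t - phi))) (- alpha) alpha ^ 2)
    <= 2 * (2 + 6 * PI) / sqrt lambda.
Proof.
intros Hl Ha.
pose proof PI_RGT_0.
assert (Hs : 0 < sqrt lambda) by (apply sqrt_lt_R0, Hl).
destruct (Rle_dec 1 lambda) as [H1|H1].
- pose proof (cos_shifted_phase_integral_le lambda phi 0 alpha H1 Ha) as HA.
  pose proof (cos_shifted_phase_integral_le lambda phi (- (PI / 2)) alpha H1 Ha)
    as HB.
  rewrite (@RInt_ext R_CompleteNormedModule _
    (fun t => cos (lambda * cos (t - phi)))) in HA
    by (intros t _; f_equal; lra).
  rewrite (@RInt_ext R_CompleteNormedModule _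
    (fun t => sin (lambda * cos (t - phi)))) in HB
    by (intros t _; rewrite <- cos_shift, <- cos_neg; f_equal; lra).
  set (A := RInt (fun t => cos (lambda * cos (t - phi))) _ _) in *.
  set (B := RInt (fun t => sin (lambda * cos (t - phi))) _ _) in *.
  apply Rle_trans with (Rabs A + Rabs B).
  + apply Rsqr_incr_0_var;
      [|pose proof (Rabs_pos A); pose proof (Rabs_pos B); lra].
    unfold Rsqr; rewrite sqrt_sqrt by nra.
    rewrite <- (pow2_abs A), <- (pow2_abs B).
    pose proof (Rabs_pos A); pose proof (Rabs_pos B); nra.
  + unfold Rdiv in *; lra.
- apply Rle_trans with (2 * alpha).
  + apply (oscillatory_integral_le (fun t => lambda * cos (t - phi))); [|lra].
    intros t; apply (@ex_derive_continuous R_AbsRing R_NormedModule).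
    auto_derive; trivial.
  + assert (sqrt lambda <= 1) by (rewrite <- sqrt_1; apply sqrt_le_1_alt; lra).
    apply (Rmult_le_reg_r (sqrt lambda)); [assumption|].
    unfold Rdiv; rewrite (Rmult_assoc _ (/ _)), Rinv_l by lra; nra.
Qed.

(** * Reduction of the kernel to real oscillatory integrals *)

Lemma enorm_sqrt (a b : R) : enorm (a, b) = sqrt (a ^ 2 + b ^ 2).
Proof.
rewrite <- (pow2_abs a), <- (pow2_abs b); reflexivity.
Qed.

Lemma polar_coordinates (a b : R) :
  exists phi, a = enorm (a, b) * cos phi /\ b = enorm (a, b) * sin phi.
Proof.
rewrite enorm_sqrt.
set (r := sqrt (a ^ 2 + b ^ 2)).
assert (Hr : r * r = a ^ 2 + b ^ 2) by (apply sqrt_sqrt; nra).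
assert (Hr0 : 0 <= r) by apply sqrt_pos.
destruct (Req_dec r 0) as [H0|H0].
- exists 0; rewrite H0 in *; split; nra.
- assert (Hu : -1 <= a / r <= 1).
  { split; apply (Rmult_le_reg_r r); try lra;
      unfold Rdiv; rewrite Rmult_assoc, Rinv_l by lra; nra. }
  assert (Hs : sin (acos (a / r)) = Rabs b / r).
  { rewrite sin_acos by exact Hu.
    replace (1 - (a / r)²) with ((b / r) ^ 2).
    - rewrite <- Rsqr_pow2, sqrt_Rsqr_abs; unfold Rdiv.
      rewrite Rabs_mult, Rabs_inv, (Rabs_right r) by lra; reflexivity.
    - unfold Rsqr; apply (Rmult_eq_reg_r (r * r)); [|nra].
      transitivity (b ^ 2); [field; lra|].
      transitivity (r * r - a ^ 2); [rewrite Hr; ring | field; lra]. }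
  (* [acos] yields the angle only up to sign; the sign of [b] decides. *)
  destruct (Rle_dec 0 b) as [Hb|Hb].
  + exists (acos (a / r)); rewrite Hs, cos_acos by exact Hu.
    rewrite Rabs_right by lra; split; field; lra.
  + exists (- acos (a / r)); rewrite cos_neg, sin_neg, Hs, cos_acos by exact Hu.
    rewrite Rabs_left by lra; split; field; lra.
Qed.

(** The factors exp(i pi / 4) cancel under conjugation, and the plane waves combine into exp(- i k
    x.(z - y)), written as its real and imaginary parts. *)
Lemma Ginf_product (k : R) (y z x : point) :
  0 < k ->
  (Ginf k z x * Cconj (Ginf k y x))%C
  = (/ (8 * k * PI) * cos (k * (dot x z - dot x y)),
     - (/ (8 * k * PI) * sin (k * (dot x z - dot x y)))).
Proof.
intros Hk.
assert (HC : forall a, Cexp (Ci * RtoC a)%C = (cos a, sin a)).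
{ intros a; unfold Cexp; simpl.
  replace (0 * a - 1 * 0) with 0 by ring.
  replace (0 * 0 + 1 * a) with a by ring.
  rewrite exp_0; apply injective_projections; simpl; ring. }
assert (HCN : forall a, Cexp (- (Ci * RtoC a))%C = (cos a, - sin a)).
{ intros a; replace (- (Ci * RtoC a))%C with (Ci * RtoC (- a))%C.
  - rewrite HC, cos_neg, sin_neg; reflexivity.
  - rewrite RtoC_opp; ring. }
unfold Ginf; rewrite HC, !HCN.
pose proof PI_RGT_0.
assert (Hp : 0 < 8 * k * PI) by (apply Rmult_lt_0_compat; lra).
set (s := sqrt (8 * k * PI)).
assert (Hs : 0 < s) by apply sqrt_lt_R0, Hp.
assert (Hss : 8 * k * PI = s * s) by (symmetry; apply sqrt_sqrt; lra).
rewrite Hss.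
rewrite Rmult_minus_distr_l, cos_minus, sin_minus.
pose proof (cos_sin_pow2 (PI / 4)) as Hcs.
set (u := cos (PI / 4)) in *; set (v := sin (PI / 4)) in *.
unfold Cdiv; rewrite <- RtoC_inv by lra.
apply injective_projections; simpl.
- transitivity ((u ^ 2 + v ^ 2) * (/ (s * s) *
    (cos (k * dot x z) * cos (k * dot x y)
     + sin (k * dot x z) * sin (k * dot x y)))); [field; lra|].
  rewrite Hcs; ring.
- transitivity ((u ^ 2 + v ^ 2) * - (/ (s * s) *
    (sin (k * dot x z) * cos (k * dot x y)
     - cos (k * dot x z) * sin (k * dot x y)))); [field; lra|].
  rewrite Hcs; ring.
Qed.

(** With [phi] a polar angle of z - y, the phase k x.(z - y) on the circle is k R cos(t - phi), and
    the arc-length density is 1. *)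
Lemma KGamma_integrals (y z : point) :
  exists phi, forall k alpha, 0 < k ->
  let psi := fun t => k * edist y z * cos (t - phi) in
  Cmod (KGamma k alpha z y) = / (8 * k * PI) *
    sqrt (RInt (fun t => cos (psi t)) (- alpha) alpha ^ 2
          + RInt (fun t => sin (psi t)) (- alpha) alpha ^ 2).
Proof.
destruct (polar_coordinates (fst y - fst z) (snd y - snd z)) as [phi [H1 H2]].
(* The phase of the integrand involves z - y, opposite to the vector in edist. *)
exists (phi + PI); intros k alpha Hk psi.
fold (edist y z) in H1, H2.
set (p := / (8 * k * PI)).
assert (Hp : 0 < p).
{ pose proof PI_RGT_0; apply Rinv_0_lt_compat.
  apply Rmult_lt_0_compat; lra. }
assert (Hpsi : forall t, continuous psi t).
{ intros t; apply (@ex_derive_continuous R_AbsRing R_NormedModule).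
  unfold psi; auto_derive; trivial. }
assert (HK : KGamma k alpha z y =
  (p * RInt (fun t => cos (psi t)) (- alpha) alpha,
   - p * RInt (fun t => sin (psi t)) (- alpha) alpha)).
{ unfold KGamma, arc_length_integral.
  apply (@is_RInt_unique C_R_CompleteNormedModule).
  apply (@is_RInt_ext C_R_NormedModule
    (fun t => (p * cos (psi t), - p * sin (psi t)))).
  - intros t _.
    assert (Hd1 : Derive (fun s => fst (circle s)) t = - sin t).
    { apply is_derive_unique; simpl; auto_derive; [trivial | ring]. }
    assert (Hd2 : Derive (fun s => snd (circle s)) t = cos t).
    { apply is_derive_unique; simpl; auto_derive; [trivial | ring]. }
    rewrite Hd1, Hd2, enorm_sqrt, Ginf_product by exact Hk.
    replace ((- sin t) ^ 2 + cos t ^ 2) with 1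
      by (rewrite <- (cos_sin_pow2 t); ring).
    rewrite sqrt_1, Cmult_1_l; fold p.
    assert (Hph : psi t = k * (dot (circle t) z - dot (circle t) y)).
    { unfold psi, dot; simpl.
      replace (t - (phi + PI)) with (t - phi - PI) by ring.
      rewrite cos_minus, cos_PI, sin_PI, cos_minus.
      transitivity (- k * (cos t * (edist y z * cos phi)
                           + sin t * (edist y z * sin phi))); [ring|].
      rewrite <- H1, <- H2; ring. }
    rewrite <- Hph; f_equal; ring.
  (* Integrate componentwise; each component is [is_RInt_cos_sin] with one coefficient equal to
     0. *)
  - apply (@is_RInt_fct_extend_pair R_NormedModule R_NormedModule); simpl.
    + apply (is_RInt_ext (fun t => p * cos (psi t) + 0 * sin (psi t)));
        [intros t _; rewrite Rmult_0_l, Rplus_0_r; reflexivity|].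
      match goal with |- is_RInt _ _ _ ?l => replace l with
        (p * RInt (fun t => cos (psi t)) (- alpha) alpha
         + 0 * RInt (fun t => sin (psi t)) (- alpha) alpha) by ring end.
      apply is_RInt_cos_sin, Hpsi.
    + apply (is_RInt_ext (fun t => 0 * cos (psi t) + - p * sin (psi t)));
        [intros t _; rewrite Rmult_0_l, Rplus_0_l; reflexivity|].
      match goal with |- is_RInt _ _ _ ?l => replace l with
        (0 * RInt (fun t => cos (psi t)) (- alpha) alpha
         + - p * RInt (fun t => sin (psi t)) (- alpha) alpha) by ring end.
      apply is_RInt_cos_sin, Hpsi. }
rewrite HK; unfold Cmod; simpl fst; simpl snd.
set (A := RInt _ _ _); set (B := RInt _ _ _).
replace ((p * A) ^ 2 + (- p * B) ^ 2) with (p ^ 2 * (A ^ 2 + B ^ 2)) by ring.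
rewrite sqrt_mult by nra.
rewrite sqrt_pow2 by lra; reflexivity.
Qed.

(** * Upper and lower bounds for the kernel, and their limits *)

Lemma KGamma_le (k alpha : R) (y z : point) :
  0 < k -> 0 < alpha -> Cmod (KGamma k alpha z y) <= alpha / (4 * k * PI).
Proof.
intros Hk Ha; pose proof PI_RGT_0.
destruct (KGamma_integrals y z) as [phi H']; rewrite (H' k alpha Hk).
replace (alpha / (4 * k * PI)) with (/ (8 * k * PI) * (2 * alpha))
  by (field; lra).
apply Rmult_le_compat_l.
- apply Rlt_le, Rinv_0_lt_compat; apply Rmult_lt_0_compat; lra.
- apply (oscillatory_integral_le (fun t => k * edist y z * cos (t - phi)));
    [|exact Ha].
  intros t; apply (@ex_derive_continuous R_AbsRing R_NormedModule).
  auto_derive; trivial.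
Qed.

Lemma edist_ge_0 (y z : point) : 0 <= edist y z.
Proof. unfold edist; rewrite enorm_sqrt; apply sqrt_pos. Qed.

(** Two bounds on the phase oscillation are merged in [Rmin 1 alpha]: the entry 1 serves the limit
    kR -> 0, the entry [alpha] the limit alpha -> 0. *)
Lemma KGamma_ge (k alpha : R) (y z : point) :
  0 < k -> 0 < alpha ->
  alpha / (4 * k * PI) * (1 - k * edist y z * Rmin 1 alpha)
    <= Cmod (KGamma k alpha z y).
Proof.
intros Hk Ha; pose proof PI_RGT_0.
destruct (KGamma_integrals y z) as [phi H']; rewrite (H' k alpha Hk).
pose proof (edist_ge_0 y z).
set (l := k * edist y z).
assert (Hl : 0 <= l) by (apply Rmult_le_pos; lra).
assert (Hc : forall t, continuous (fun t => l * cos (t - phi)) t).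
{ intros t; apply (@ex_derive_continuous R_AbsRing R_NormedModule).
  auto_derive; trivial. }
replace (alpha / (4 * k * PI) * (1 - l * Rmin 1 alpha))
  with (/ (8 * k * PI) * (2 * alpha * (1 - l * Rmin 1 alpha)))
  by (field; lra).
apply Rmult_le_compat_l.
- apply Rlt_le, Rinv_0_lt_compat; apply Rmult_lt_0_compat; lra.
- apply Rmin_case.
  (* Compare with phase 0: the phase never exceeds [l] in absolute value. *)
  + apply (oscillatory_integral_ge _ alpha 0); [exact Hc | exact Ha |].
    intros t _; rewrite Rminus_0_r, Rabs_mult, (Rabs_right l) by lra.
    apply Rmult_le_compat_l; [lra|].
    apply Rabs_le; pose proof (COS_bound (t - phi)); lra.
  (* Compare with the phase at the midpoint t = 0, using that cosine is 1-Lipschitz. *)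
  + apply (oscillatory_integral_ge _ alpha (l * cos (- phi)));
      [exact Hc | exact Ha |].
    intros t Ht; rewrite <- Rmult_minus_distr_l, Rabs_mult, (Rabs_right l) by lra.
    apply Rmult_le_compat_l; [lra|].
    apply Rle_trans with (1 := cos_lipschitz _ _).
    replace (t - phi - - phi) with t by ring; exact Ht.
Qed.

Lemma KGamma_decay (k alpha : R) (y z : point) :
  0 < k -> 0 < alpha <= PI -> 0 < edist y z ->
  Cmod (KGamma k alpha z y)
    <= (2 + 6 * PI) / (4 * PI)
       * Rpower k (- (3 / 2)) * Rpower (edist y z) (- (1 / 2)).
Proof.
intros Hk Ha Hr; pose proof PI_RGT_0.
destruct (KGamma_integrals y z) as [phi H']; rewrite (H' k alpha Hk).
set (r := edist y z) in *.
assert (Hkr : 0 < k * r) by (apply Rmult_lt_0_compat; assumption).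
assert (Hsk : 0 < sqrt k) by apply sqrt_lt_R0, Hk.
assert (Hsr : 0 < sqrt r) by apply sqrt_lt_R0, Hr.
replace (Rpower k (- (3 / 2))) with (/ (k * sqrt k)).
2: { rewrite Rpower_Ropp; f_equal.
     replace (3 / 2) with (1 + / 2) by lra.
     rewrite Rpower_plus, Rpower_1, Rpower_sqrt by exact Hk; reflexivity. }
replace (Rpower r (- (1 / 2))) with (/ sqrt r).
2: { rewrite Rpower_Ropp; f_equal.
     replace (1 / 2) with (/ 2) by lra.
     rewrite Rpower_sqrt by exact Hr; reflexivity. }
replace ((2 + 6 * PI) / (4 * PI) * / (k * sqrt k) * / sqrt r)
  with (/ (8 * k * PI) * (2 * (2 + 6 * PI) / sqrt (k * r))).
- apply Rmult_le_compat_l.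
  + apply Rlt_le, Rinv_0_lt_compat; apply Rmult_lt_0_compat; lra.
  + apply oscillatory_integral_decay; assumption.
- rewrite sqrt_mult by lra; field; repeat split; lra.
Qed.

Theorem lemma3p3 :
  (exists c : R, 0 < c /\
     forall (k alpha : R) (y z : point),
       0 < k -> 0 < alpha <= PI -> 0 < edist y z ->
       Cmod (KGamma k alpha z y)
         <= c * Rpower k (- (3 / 2)) * Rpower (edist y z) (- (1 / 2)))
  /\
  ((forall alpha : R, 0 < alpha <= PI ->
      forall eps : R, 0 < eps ->
      exists delta : R, 0 < delta /\
        forall (k : R) (y z : point),
          0 < k -> k * edist y z < delta ->
          Rabs (k * Cmod (KGamma k alpha z y) - alpha / (4 * PI)) < eps)
   /\
   (forall (k alpha : R) (y z : point),
      0 < k -> 0 < alpha <= PI ->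
      Cmod (KGamma k alpha z y) <= alpha / (4 * k * PI))
   /\
   (forall (k alpha : R) (y : point),
      0 < k -> 0 < alpha <= PI ->
      Cmod (KGamma k alpha y y) = alpha / (4 * k * PI)))
  /\
  (forall (k : R) (y z : point), 0 < k ->
     is_domin (at_right 0)
       (fun alpha : R => alpha)
       (fun alpha : R => Cmod (KGamma k alpha z y) - alpha / (4 * k * PI))).
Proof.
pose proof PI_RGT_0 as Hpi.
split; [|split; [split; [|split]|]].
- exists ((2 + 6 * PI) / (4 * PI)); split.
  + apply Rdiv_lt_0_compat; lra.
  + exact KGamma_decay.
(* [delta = eps] works: the defect is at most alpha / (4 pi) times kR, and alpha / (4 pi) <= 1. *)
- intros alpha Ha eps He; exists eps; split; [exact He|].
  intros k y z Hk Hd.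
  pose proof (KGamma_le k alpha y z Hk (proj1 Ha)) as Hle.
  pose proof (KGamma_ge k alpha y z Hk (proj1 Ha)) as Hge.
  apply (Rmult_le_compat_l k) in Hle; [|lra].
  apply (Rmult_le_compat_l k) in Hge; [|lra].
  set (l := k * edist y z) in *.
  assert (Hl : 0 <= l) by (apply Rmult_le_pos; [lra | apply edist_ge_0]).
  replace (k * (alpha / (4 * k * PI))) with (alpha / (4 * PI)) in Hle
    by (field; lra).
  replace (k * (alpha / (4 * k * PI) * (1 - l * Rmin 1 alpha)))
    with (alpha / (4 * PI) - alpha / (4 * PI) * (l * Rmin 1 alpha)) in Hge
    by (field; lra).
  assert (Hq : 0 <= alpha / (4 * PI) <= 1).
  { split; [apply Rlt_le, Rdiv_lt_0_compat; lra|].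
    apply (Rmult_le_reg_r (4 * PI)); [lra|].
    unfold Rdiv; rewrite Rmult_assoc, Rinv_l by lra; lra. }
  assert (Hm : 0 <= l * Rmin 1 alpha <= l).
  { assert (0 <= Rmin 1 alpha) by (apply Rmin_glb; lra).
    pose proof (Rmin_l 1 alpha); split; nra. }
  apply Rabs_lt_between; split; nra.
- intros k alpha y z Hk Ha; apply KGamma_le; tauto.
- intros k alpha y Hk Ha; apply Rle_antisym.
  + apply KGamma_le; tauto.
  (* At zero distance the lower bound meets the upper one. *)
  + pose proof (KGamma_ge k alpha y y Hk (proj1 Ha)) as H.
    unfold edist in H; rewrite enorm_sqrt, !Rminus_diag in H.
    replace (0 ^ 2 + 0 ^ 2) with 0 in H by ring.
    rewrite sqrt_0 in H; lra.
- intros k y z Hk eps.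
  (* The defect is at most [m * alpha ^ 2], so alpha < eps / (m + 1) suffices; the added 1 keeps the
     quotient meaningful when [m = 0]. *)
  set (m := edist y z / (4 * PI)).
  assert (Hm : 0 <= m).
  { pose proof (edist_ge_0 y z).
    apply Rmult_le_pos; [lra | apply Rlt_le, Rinv_0_lt_compat; lra]. }
  assert (Hd : 0 < eps / (m + 1))
    by (apply Rdiv_lt_0_compat; [apply cond_pos | lra]).
  exists (mkposreal _ Hd); intros alpha Hball Ha.
  change (Rabs (alpha - 0) < eps / (m + 1)) in Hball.
  change (Rabs (Cmod (KGamma k alpha z y) - alpha / (4 * k * PI))
          <= eps * Rabs alpha).
  rewrite Rminus_0_r in Hball; rewrite (Rabs_right alpha) in Hball |- * by lra.
  assert (Hma : alpha * (m + 1) < eps).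
  { apply (Rmult_lt_compat_r (m + 1)) in Hball; [|lra].
    unfold Rdiv in Hball; rewrite Rmult_assoc, Rinv_l in Hball by lra; lra. }
  pose proof (KGamma_le k alpha y z Hk Ha) as Hle.
  pose proof (KGamma_ge k alpha y z Hk Ha) as Hge.
  assert (alpha * m * Rmin 1 alpha <= alpha * m * alpha).
  { apply Rmult_le_compat_l; [nra | apply Rmin_r]. }
  replace (alpha / (4 * k * PI) * (1 - k * edist y z * Rmin 1 alpha))
    with (alpha / (4 * k * PI) - alpha * m * Rmin 1 alpha) in Hge
    by (unfold m; field; lra).
  rewrite Rabs_left1 by lra.
  nra.
Qed.
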